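(* Let $A \in \mathbb{R}^{m \times n}$ be an entrywise nonnegative matrix. Let $\nu_+(A)$ be the optimal value of the following convex optimization program: \[ \nu_+(A) = \max_{W \in \mathbb{R}^{m \times n}} \left\{ \langle A, W \rangle \; : \; \begin{bmatrix} I & -W\\ -W^{T} & I \end{bmatrix} \text{ copositive} \right\}. \] Then \[ \operatorname{rank}_+(A) \geq \left(\frac{\nu_+(A)}{\|A\|_F}\right)^2, \] where $\|A\|_F := \sqrt{\sum_{i,j} A_{i,j}^2}$ is the Frobenius norm of $A$.
   Context: The nonnegative rank $\operatorname{rank}_+(A)$ of an entrywise nonnegative matrix $A\in\mathbb{R}^{m\times n}$ is the smallest integer $r$ such that $A=UV$ with $U\in\mathbb{R}^{m\times r}$ and $V\in\mathbb{R}^{r\times n}$ both entrywise nonnegative. A symmetric matrix $M \in \mathbb{R}^{N\times N}$ is copositive if $x^{T} M x \geq 0$ for all entrywise nonnegative $x\in \mathbb{R}^{N}$. The inner product is $\langle X,Y\rangle = \operatorname{trace}(X^{T}Y)=\sum_{i,j}X_{i,j}Y_{i,j}$, and $I$ denotes the identity matrix of the appropriate size. *)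

(* Defs.v *)
From mathcomp Require Import all_boot all_order all_algebra.
From mathcomp Require Import boolp classical_sets reals.

Set Implicit Arguments.
Unset Strict Implicit.
Unset Printing Implicit Defensive.

Import Order.TTheory GRing.Theory Num.Theory.
Local Open Scope classical_set_scope.
Local Open Scope ring_scope.

Definition nonneg_mx (R : realType) m n (A : 'M[R]_(m, n)) : Prop :=
  forall i j, 0 <= A i j.

Definition has_nonneg_factorization (R : realType) m n (A : 'M[R]_(m, n))
    (r : nat) : Prop :=
  exists (U : 'M[R]_(m, r)) (V : 'M[R]_(r, n)),
    [/\ nonneg_mx U, nonneg_mx V & A = U *m V].

(* The default 0 is returned only when no factorization exists at all, which
   never happens for an entrywise nonnegative A: see [nonneg_rankP]. *)
Definition nonneg_rank (R : realType) m n (A : 'M[R]_(m, n)) : nat :=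
  xget 0%N [set r | has_nonneg_factorization A r /\
                    forall s, has_nonneg_factorization A s -> (r <= s)%N].

Definition copositive (R : realType) N (M : 'M[R]_N) : Prop :=
  M^T = M /\
  forall x : 'cV[R]_N, nonneg_mx x -> 0 <= (x^T *m M *m x) 0 0.

Definition mx_inner (R : realType) m n (X Y : 'M[R]_(m, n)) : R :=
  \tr (X^T *m Y).

Definition nu_plus_feasible (R : realType) m n : set 'M[R]_(m, n) :=
  [set W | copositive (block_mx 1%:M (- W) (- W^T) 1%:M)].
Arguments nu_plus_feasible : clear implicits.

(* The real-valued [sup] is meaningful because, for an entrywise nonnegative A,
   the program is feasible and bounded: see [has_sup_nu_plus]. *)
Definition nu_plus (R : realType) m n (A : 'M[R]_(m, n)) : R :=
  sup [set mx_inner A W | W in nu_plus_feasible R m n].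

Definition frobenius_norm (R : realType) m n (A : 'M[R]_(m, n)) : R :=
  Num.sqrt (\sum_i \sum_j A i j ^+ 2).

Lemma nonneg_rankP (R : realType) m n (A : 'M[R]_(m, n)) :
  nonneg_mx A ->
  has_nonneg_factorization A (nonneg_rank A) /\
  forall s, has_nonneg_factorization A s -> (nonneg_rank A <= s)%N.
Proof.
move=> A0; rewrite /nonneg_rank; set P := [set r | _].
suff [r Pr] : exists r, P r by exact: (@xgetPex _ 0%N P (ex_intro _ r Pr)).
have ex : exists r, `[< has_nonneg_factorization A r >].
  exists n; apply/asboolP; exists A, 1%:M; split; rewrite ?mulmx1//.
  by move=> i j; rewrite mxE ler0n.
case: (ex_minnP ex) => r /asboolP Ar rmin.
by exists r; split=> // s As; apply/rmin/asboolP.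
Qed.

Lemma mx_innerE (R : realType) m n (X Y : 'M[R]_(m, n)) :
  mx_inner X Y = \sum_i \sum_j X i j * Y i j.
Proof.
rewrite /mx_inner /mxtrace exchange_big; apply: eq_bigr => j _.
by rewrite mxE; apply: eq_bigr => i _; rewrite mxE.
Qed.

Lemma block_quadE (R : realType) m n (W : 'M[R]_(m, n))
    (x : 'cV[R]_m) (y : 'cV[R]_n) :
  ((col_mx x y)^T *m block_mx 1%:M (- W) (- W^T) 1%:M *m col_mx x y) 0 0 =
  (x^T *m x) 0 0 + (y^T *m y) 0 0 - (x^T *m W *m y) 0 0 *+ 2.
Proof.
have tE : y^T *m W^T *m x = (x^T *m W *m y)^T by rewrite !trmx_mul trmxK mulmxA.
rewrite tr_col_mx mul_row_block !mulmxN !mulmx1 mul_row_col !mulmxDl !mulNmx tE.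
rewrite !mxE /= mulr2n opprD -!addrA. congr (_ + _).
by rewrite addrA addrC.
Qed.

Lemma nu_plus_feasible_le1 (R : realType) m n (W : 'M[R]_(m, n)) i j :
  nu_plus_feasible R m n W -> W i j <= 1.
Proof.
case=> _ /(_ (col_mx (delta_mx i 0) (delta_mx j 0))) W0.
have /W0 : nonneg_mx (col_mx (delta_mx i 0) (delta_mx j 0) : 'cV[R]_(m + n)).
  by move=> k l; rewrite mxE; case: splitP => k' _; rewrite mxE ler0n.
rewrite block_quadE !trmx_delta -!rowE.
rewrite -colE !mxE !eqxx /= -mulr2n -mulrnBl.
by rewrite pmulrn_lge0// subr_ge0.
Qed.

Lemma nu_plus_feasible0 (R : realType) m n : nu_plus_feasible R m n 0.
Proof.
rewrite /nu_plus_feasible /= trmx0 !oppr0; split=> [|x _].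
  by rewrite tr_block_mx !trmx0 !trmx1.
rewrite -scalar_mx_block mulmx1 mxE sumr_ge0// => i _.
by rewrite mxE -expr2 sqr_ge0.
Qed.

Lemma has_sup_nu_plus (R : realType) m n (A : 'M[R]_(m, n)) :
  nonneg_mx A -> has_sup [set mx_inner A W | W in nu_plus_feasible R m n].
Proof.
move=> A0; split.
  by exists (mx_inner A 0), 0 => //; exact: nu_plus_feasible0.
exists (\sum_i \sum_j A i j) => _ [W WF <-]; rewrite mx_innerE.
apply: ler_sum => i _; apply: ler_sum => j _.
by rewrite -[leRHS]mulr1 ler_wpM2l// nu_plus_feasible_le1.
Qed.

(* Main.v *)
(** Write [A] as a sum of [r] nonnegative rank-one matrices [u_k v_k^T].  For a
    feasible [W], copositivity tested on [(|v| u, |u| v)] gives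
    [u^T W v <= |u| |v|].  Hence [<A, W> <= \sum_k |u_k| |v_k|], which by
    Cauchy-Schwarz is at most [sqrt r] times the square root of
    [\sum_k |u_k v_k^T|_F^2].  As all the entries are nonnegative, that last
    sum is at most [|A|_F^2]. *)

Require Import Defs.
From mathcomp Require Import all_boot all_order all_algebra.
From mathcomp Require Import boolp classical_sets reals.
From mathcomp Require Import lra.

Set Implicit Arguments.
Unset Strict Implicit.
Unset Printing Implicit Defensive.

Import Order.TTheory GRing.Theory Num.Theory.
Local Open Scope ring_scope.

(** Cauchy-Schwarz against the all-ones vector, obtained by summing
    [x i * x j <= (x i ^+ 2 + x j ^+ 2) / 2] over all pairs. *)
Lemma sqr_sum_le (R : realFieldType) (I : finType) (x : I -> R) :
  (\sum_i x i) ^+ 2 <= #|I|%:R * \sum_i x i ^+ 2.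
Proof.
have le2 (i j : I) : x i * x j <= (x i ^+ 2 + x j ^+ 2) / 2.
  have := sqr_ge0 (x i - x j); nra.
rewrite expr2 big_distrlr /=.
apply: (@le_trans _ _ (\sum_i \sum_j (x i ^+ 2 + x j ^+ 2) / 2)).
  by apply: ler_sum => i _; apply: ler_sum => j _.
under [leLHS]eq_bigr do rewrite -mulr_suml big_split sumr_const.
by rewrite -mulr_suml big_split sumr_const sumrMnl /= mulr_natl mulrDl -splitr.
Qed.

(** Expanding the square on the right only adds nonnegative cross terms. *)
Lemma sum_sqr_le (R : realDomainType) (I : finType) (x : I -> R) :
  (forall i, 0 <= x i) -> \sum_i x i ^+ 2 <= (\sum_i x i) ^+ 2.
Proof.
move=> x0; rewrite [leRHS]expr2 mulr_suml; apply: ler_sum => i _.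
rewrite expr2 ler_wpM2l// (bigD1 i)//= lerDl.
by apply: sumr_ge0 => j _.
Qed.

Lemma dotE (R : realType) m (x : 'cV[R]_m) :
  (x^T *m x) 0 0 = \sum_i x i 0 ^+ 2.
Proof. by rewrite mxE; apply: eq_bigr => i _; rewrite mxE expr2. Qed.

Lemma dot_ge0 (R : realType) m (x : 'cV[R]_m) : 0 <= (x^T *m x) 0 0.
Proof. by rewrite dotE sumr_ge0// => i _; rewrite sqr_ge0. Qed.

Lemma dot_eq0 (R : realType) m (x : 'cV[R]_m) : (x^T *m x) 0 0 = 0 -> x = 0.
Proof.
rewrite dotE => /psumr_eq0P x0; apply/colP => i.
by apply/eqP; rewrite mxE -sqrf_eq0 x0// => j _; rewrite sqr_ge0.
Qed.

Lemma feasible_bilinear_le (R : realType) m n (W : 'M[R]_(m, n))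
    (u : 'cV[R]_m) (v : 'cV[R]_n) :
  nu_plus_feasible R m n W -> nonneg_mx u -> nonneg_mx v ->
  (u^T *m W *m v) 0 0 <=
    Num.sqrt ((u^T *m u) 0 0) * Num.sqrt ((v^T *m v) 0 0).
Proof.
move=> [_ W0] u0 v0.
(* Zero vectors are set aside because the main case cancels the factor [|u| |v|], which must be
   positive. *)
have [->|u_neq0] := eqVneq u 0.
  by rewrite trmx0 !mul0mx mxE sqrtr0 mul0r.
have [->|v_neq0] := eqVneq v 0.
  by rewrite trmx0 mulmx0 mul0mx mxE sqrtr0 mulr0.
have norm_gt0 k (x : 'cV[R]_k) : x != 0 -> 0 < Num.sqrt ((x^T *m x) 0 0).
  move=> x_neq0; rewrite sqrtr_gt0 lt_def dot_ge0 andbT.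
  by apply: contra_neq x_neq0; exact: dot_eq0.
have a0 := norm_gt0 _ _ u_neq0; have b0 := norm_gt0 _ _ v_neq0.
have := sqr_sqrtr (dot_ge0 u); have := sqr_sqrtr (dot_ge0 v).
set a := Num.sqrt _ in a0 *; set b := Num.sqrt _ in b0 * => bE aE.
have /W0 : nonneg_mx (col_mx (b *: u) (a *: v)).
  by move=> i j; rewrite mxE; case: splitP => k _; rewrite mxE mulr_ge0// ltW.
rewrite block_quadE !linearZ /= -!scalemxAl !(mxE scalemx_key) -aE -bE => le0.
(* At the test vector the quadratic form is [2 a^2 b^2 - 2 a b q], with [q] the bilinear value; the
   goal is scaled by [a * b] to match. *)
rewrite -(ler_pM2l (mulr_gt0 a0 b0)); move: le0.
set q := (u^T *m W *m v) 0 0; rewrite mulr2n; lra.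
Qed.

(** By cyclicity the inner product is the trace of [U^T *m W *m V^T], whose diagonal entries are the
    summands. *)
Lemma mx_inner_mulmx (R : realType) m n r (U : 'M[R]_(m, r)) (V : 'M[R]_(r, n))
    (W : 'M[R]_(m, n)) :
  mx_inner (U *m V) W = \sum_k ((col k U)^T *m W *m (row k V)^T) 0 0.
Proof.
rewrite /mx_inner trmx_mul -mulmxA mxtrace_mulC; apply: eq_bigr => k _.
rewrite tr_col tr_row -row_mul [LHS]mxE [RHS]mxE; apply: eq_bigr => j _.
by rewrite [row _ _ _ _]mxE [col _ _ _ _]mxE.
Qed.

Lemma sum_rank1_norm_le (R : realType) m n r (U : 'M[R]_(m, r))
    (V : 'M[R]_(r, n)) :
  nonneg_mx U -> nonneg_mx V ->
  \sum_k (\sum_i U i k ^+ 2) * (\sum_j V k j ^+ 2) <=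
    \sum_i \sum_j (U *m V) i j ^+ 2.
Proof.
move=> U0 V0; under [leLHS]eq_bigr do rewrite big_distrlr.
rewrite [leLHS]exchange_big; apply: ler_sum => i _.
rewrite [leLHS]exchange_big; apply: ler_sum => j _.
under [leLHS]eq_bigr do rewrite /= -exprMn.
by rewrite mxE sum_sqr_le// => k; rewrite mulr_ge0.
Qed.

Lemma mx_inner_le (R : realType) m n r (U : 'M[R]_(m, r)) (V : 'M[R]_(r, n))
    (W : 'M[R]_(m, n)) :
  nonneg_mx U -> nonneg_mx V -> nu_plus_feasible R m n W ->
  mx_inner (U *m V) W <= Num.sqrt r%:R * frobenius_norm (U *m V).
Proof.
move=> U0 V0 WF; rewrite mx_inner_mulmx.
(* [x k] is the Frobenius norm of the [k]-th rank-one term. *)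
pose x k := Num.sqrt (\sum_i U i k ^+ 2) * Num.sqrt (\sum_j V k j ^+ 2).
have sum0 (I : finType) (f : I -> R) : 0 <= \sum_i f i ^+ 2.
  by apply: sumr_ge0 => i _; exact: sqr_ge0.
apply: (@le_trans _ _ (\sum_k x k)).
  apply: ler_sum => k _.
  apply: le_trans (feasible_bilinear_le WF _ _) _.
  - by move=> i j; rewrite !mxE.
  - by move=> i j; rewrite !mxE.
  rewrite !dotE /x.
  under eq_bigr do rewrite mxE.
  by under [X in _ * Num.sqrt X]eq_bigr do rewrite !mxE.
rewrite /frobenius_norm -sqrtrM ?ler0n//.
apply: (le_trans (ler_norm _)); rewrite -sqrtr_sqr ler_wsqrtr//.
apply: (le_trans (sqr_sum_le _)); rewrite card_ord ler_wpM2l ?ler0n//.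
apply: le_trans (sum_rank1_norm_le U0 V0); apply: ler_sum => k _.
by rewrite exprMn !sqr_sqrtr.
Qed.

Theorem theorem1 (R : realType) (m n : nat) (A : 'M[R]_(m, n)) (A_ge0 : nonneg_mx A) :
  (nonneg_rank A)%:R >= (nu_plus A / frobenius_norm A) ^+ 2.
Proof.
have [[U [V [U0 V0 AE]]] _] := nonneg_rankP A_ge0.
have supA := has_sup_nu_plus A_ge0.
(* The sign is needed to compare squares at the end. *)
have nu0 : 0 <= nu_plus A.
  apply: (ub_le_sup supA.2); exists 0; first exact: nu_plus_feasible0.
  by rewrite /mx_inner mulmx0 mxtrace0.
have nu_le : nu_plus A <= Num.sqrt (nonneg_rank A)%:R * frobenius_norm A.
  apply: ge_sup supA.1 _ => _ [W WF <-].
  by have := mx_inner_le U0 V0 WF; rewrite -AE.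
(* If the norm vanishes, the quotient is 0 by the convention [0^-1 = 0]. *)
have [->|F_neq0] := eqVneq (frobenius_norm A) 0.
  by rewrite invr0 mulr0 expr0n ler0n.
have F_gt0 : 0 < frobenius_norm A by rewrite lt_def F_neq0 sqrtr_ge0.
rewrite -[leRHS]sqr_sqrtr ?ler0n// lerXn2r ?nnegrE ?sqrtr_ge0//.
  by rewrite divr_ge0// ltW.
by rewrite ler_pdivrMr.
Qed.
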